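(* Let $G$ be a graph with $V(G)=\{v_1,\ldots,v_n\}$ and let $\mathcal{H}=(L,H)$ be a prime cover of $G$ of order $3$, with the vertices of $H$ arbitrarily named so that $L(v)\subseteq\{(v,j):j\in\mathbb{F}_3\}$ for each $v\in V(G)$. Let $$f(x_1,\ldots,x_n)=\prod_{v_iv_j\in E(G),\, j>i}\big(x_i+B(\sigma_{v_iv_j})\,x_j\big)\in\mathbb{F}_3[x_1,\ldots,x_n].$$ If $t_1,\ldots,t_n$ are nonnegative integers such that the coefficient of $\prod_{i=1}^n x_i^{t_i}$ in $f$ is nonzero and $|L(v_i)|>t_i$ for each $i\in[n]$, then there is an $\mathcal{H}$-coloring of $G$.
   Context: All graphs are finite and simple. A cover of a graph $G$ is a pair $\mathcal{H}=(L,H)$ where $H$ is a graph and $L:V(G)\to\mathcal{P}(V(H))$ satisfies: (1) $\{L(u)\}$ partitions $V(H)$; (2) each $H[L(u)]$ is complete; (3) if $E_H(L(u),L(v))\neq\emptyset$ then $u=v$ or $uv\in E(G)$; (4) if $uv\in E(G)$ then $E_H(L(u),L(v))$ is a matching (possibly empty). An $\mathcal{H}$-coloring is an independent set of $H$ of size $|V(G)|$. A prime cover of order $3$ is a cover with $|L(v)|\le 3$ for all $v$. With the given naming, for an edge $v_iv_j$, $j>i$, the saturation function $\sigma_{v_iv_j}$ maps each $q\in\mathbb{F}_3$ with $(v_i,q)$ saturated by $E_H(L(v_i),L(v_j))$ to the unique $r$ with $(v_i,q)(v_j,r)\in E(H)$. It is good if $q-\sigma_{v_iv_j}(q)$ is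 the same element of $\mathbb{F}_3$ for all $q$ in its domain (vacuously good if empty), and bad otherwise. $B(\sigma_{v_iv_j})=-1$ if $\sigma_{v_iv_j}$ is good and $B(\sigma_{v_iv_j})=1$ if it is bad. *)

(* Defs.v *)
From HB Require Import structures.
From mathcomp Require Import all_boot all_order all_algebra.
From mathcomp Require Import mpoly.

Set Implicit Arguments.
Unset Strict Implicit.
Unset Printing Implicit Defensive.

Import GRing.Theory.
Local Open Scope ring_scope.

Record sgraph := SGraph {
  vertex :> finType;
  adj : rel vertex;
  adj_sym : ssrbool.symmetric adj;
  adj_irr : irreflexive adj
}.

Arguments adj {s} _ _.

(* Edges are unordered pairs, encoded as two-element sets. *)
Definition edges_between (H : sgraph) (A B : {set H}) : {set {set H}} :=
  [set e | [exists x in A, exists y in B, adj x y && (e == [set x; y])]].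

(* Meant for sets M of edges: distinct edges of M share no endpoint. *)
Definition matching (H : sgraph) (M : {set {set H}}) : bool := trivIset M.

(* Parts L u may be empty, so disjointness is stated for the indexed family
   rather than through [partition]. *)
Definition is_cover (G H : sgraph) (L : G -> {set H}) : Prop :=
  [/\ \bigcup_(u : G) L u = [set: H] /\
        (forall u v : G, u != v -> [disjoint L u & L v]),
      forall (u : G) (x y : H), x \in L u -> y \in L u -> x != y -> adj x y,
      forall u v : G, edges_between (L u) (L v) != set0 -> u = v \/ adj u v
    & forall u v : G, adj u v -> matching (edges_between (L u) (L v))].

Definition prime_cover3 (G H : sgraph) (L : G -> {set H}) : Prop :=
  is_cover L /\ forall v : G, (#|L v| <= 3)%N.

Definition independent (H : sgraph) (I : {set H}) : Prop :=
  forall x y : H, x \in I -> y \in I -> ~~ adj x y.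

Definition is_coloring (G H : sgraph) (I : {set H}) : Prop :=
  independent I /\ #|I| = #|G|.

Definition is_naming (G H : sgraph) (L : G -> {set H})
    (name : H -> G * 'F_3) : Prop :=
  injective name /\
  forall v : G, name @: L v \subset [set (v, j) | j : 'F_3].

Section Saturation.
Variables (G H : sgraph) (name : H -> G * 'F_3).

(* The partial function sigma_{uv}; None means that (u, q) is not saturated by
   E_H(L(u), L(v)). The lists L(u) and L(v) need not be mentioned: under
   [is_cover] and [is_naming], a vertex named (u, q) lies in L(u). *)
Definition saturation (u v : G) (q : 'F_3) : option 'F_3 :=
  [pick r : 'F_3 | [exists x : H, exists y : H,
     [&& name x == (u, q), name y == (v, r) & adj x y]]].

Definition good (u v : G) : bool :=
  [exists c : 'F_3, forall q : 'F_3, forall r : 'F_3,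
     (saturation u v q == Some r) ==> (q - r == c)].

Definition Bsign (u v : G) : 'F_3 := if good u v then -1 else 1.

Definition cover_poly (n : nat) (v : 'I_n -> G) : {mpoly 'F_3[n]} :=
  \prod_(p : 'I_n * 'I_n | adj (v p.1) (v p.2) && (p.1 < p.2)%N)
     ('X_(p.1) + Bsign (v p.1) (v p.2) *: 'X_(p.2)).

End Saturation.

(* Main.v *)
Require Import Defs.
From mathcomp Require Import all_boot all_order all_algebra.
From mathcomp Require Import mpoly.
From mathcomp Require Import ring.

(** A partial injection of [F_3] with at least two points in its domain extends
    to a permutation of [F_3], which is either a translation or a reflection
    [q |-> c - q]. Hence for every edge [v_i v_j] there is a constant [c] such
    that [x_i + B x_j - c] vanishes on every conflicting pair of colors.
    Subtracting these constants from the factors of [f] does not change the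
    coefficients of maximal degree, so the Combinatorial Nullstellensatz yields
    a choice of colors at which no factor vanishes. *)

Set Implicit Arguments.
Unset Strict Implicit.
Unset Printing Implicit Defensive.

Import GRing.Theory.
Local Open Scope ring_scope.

(** * The Combinatorial Nullstellensatz *)

(** The weights form column [k] of the inverse of the Vandermonde matrix of the nodes, which is
    invertible because the nodes are distinct. *)
Lemma moment_weights (F : fieldType) (s : seq F) (k : nat) :
  uniq s -> (k < size s)%N ->
  exists w : nat -> F, forall j : nat, (j < size s)%N ->
    \sum_(i < size s) w i * s`_i ^+ j = (j == k)%:R.
Proof.
move=> s_uniq ks; set m := size s in ks *.
pose V := Vandermonde m (\row_(i < m) s`_i).
have V_unit : V \in unitmx.
  rewrite unitmxE unitfE det_Vandermonde.
  apply/prodf_neq0 => i _; apply/prodf_neq0 => j ij.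
  by rewrite !mxE subr_eq0 nth_uniq ?ltn_ord // gtn_eqF.
pose W : 'cV_m := invmx V *m delta_mx (Ordinal ks) 0.
exists (fun i => if insub i is Some o then W o 0 else 0) => j jm.
have /matrixP/(_ (Ordinal jm) 0) : V *m W = delta_mx (Ordinal ks) 0.
  by rewrite mulmxA mulmxV // mul1mx.
rewrite !mxE eqxx andbT -val_eqE /= => <-; apply: eq_bigr => i _.
by rewrite valK mulrC !mxE.
Qed.

Lemma mnm_ltn_coord (n : nat) (m t : 'X_{1..n}) :
  (mdeg m <= mdeg t)%N -> m != t -> exists i : 'I_n, (m i < t i)%N.
Proof.
move=> mt; have [/existsP //|] := boolP [exists i, m i < t i]%N.
rewrite negb_exists => /forallP tm /eqP[].
have tm' i : (t i <= m i)%N by rewrite leqNgt tm.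
apply/mnmP => i; apply/eqP; rewrite eq_sym; move: i.
apply/forallP.
have [_ <-] := leqif_sum (fun i (_ : xpredT i) => leqif_eq (tm' i)).
by rewrite -!mdegE eqn_leq mt !mdegE leq_sum.
Qed.

(* The weights of [moment_weights] turn the sum of the values of [p] on the
   grid into the single coefficient [p@_t]. *)
Lemma combinatorial_nullstellensatz (F : fieldType) (n : nat)
    (p : {mpoly F[n]}) (t : 'X_{1..n}) (S : 'I_n -> seq F) :
  p@_t != 0 -> (forall m, m \in msupp p -> (mdeg m <= mdeg t)%N) ->
  (forall i, uniq (S i)) -> (forall i, (t i < size (S i))%N) ->
  exists2 a : 'I_n -> F, (forall i, a i \in S i) & p.@[a] != 0.
Proof.
move=> pt p_deg S_uniq tS.
have [w wE] := fin_all_exists (fun i => moment_weights (S_uniq i) (tS i)).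
(* A common index type ['I_N] makes grid points plain finite functions; [Q i] keeps the indices
   valid in [S i]. *)
pose N := \max_i size (S i).
have SN i : (size (S i) <= N)%N by apply: (leq_bigmax i).
pose Q i := [pred j : 'I_N | (j < size (S i))%N].
pose a (f : {ffun 'I_n -> 'I_N}) i := (S i)`_(f i).
have sumE : \sum_(f in family Q) (\prod_i w i (f i)) * p.@[a f] = p@_t.
  (* Expanding [p] and exchanging the sums turns each monomial [m] into its coefficient times a
     product over [i] of weighted power sums. *)
  under eq_bigr do rewrite mevalE mulr_sumr.
  rewrite exchange_big /=.
  under eq_bigr => m _.
    under eq_bigr do rewrite mulrCA -big_split /=.
    rewrite -mulr_sumr.
    rewrite -(bigA_distr_big_dep Q (fun i j => w i j * (S i)`_j ^+ m i)).
    under eq_bigr => i _.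
      rewrite -(big_ord_widen N (fun j => w i j * (S i)`_j ^+ m i) (SN i)).
      over.
    over.
  rewrite /= (bigD1_seq t) ?msupp_uniq ?mcoeff_msupp //=.
  rewrite [X in _ * X]big1 ?mulr1; last by move=> i _; rewrite wE ?eqxx.
  rewrite big_seq_cond big1 ?addr0 // => m /andP[mp mt].
  (* Other exponents of [m] may exceed the range of [wE]; one coordinate below [t i] already gives a
     zero factor. *)
  have [i mi] := mnm_ltn_coord (p_deg m mp) mt.
  by rewrite (bigD1 i) //= wE ?(ltn_trans mi) // ltn_eqF // mul0r mulr0.
have [f /andP[/familyP fQ pf]|p0] :=
    pickP [pred f | (f \in family Q) && (p.@[a f] != 0)].
  by exists (a f) => // i; apply/mem_nth/fQ.
move: pt; rewrite -sumE big1 ?eqxx // => f fQ.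
by move: (p0 f); rewrite /= fQ => /negbFE/eqP->; rewrite mulr0.
Qed.

(** * Homogeneous parts of top degree *)

(** [y] may be zero, so [d] only bounds the degree of [x]; this keeps the notion stable under
    products even with zero divisors. *)
Definition leading_form (R : nzRingType) (n d : nat) (x y : {mpoly R[n]}) :=
  y \is d.-homog /\ forall m, m \in msupp (x - y) -> (mdeg m < d)%N.

Lemma leading_formM (R : comNzRingType) (n d e : nat)
    (x y x' y' : {mpoly R[n]}) :
  leading_form d x y -> leading_form e x' y' ->
  leading_form (d + e) (x * x') (y * y').
Proof.
move=> [/[dup] yd /dhomogP ydE xy] [/[dup] ye /dhomogP yeE xy'].
split=> [|m]; first exact: dhomogM.
(* Each product on the right has [x - y] or [x' - y'] as a factor, hence only monomials of degree
   below [d + e]. *)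
have -> : x * x' - y * y' =
    (x - y) * (x' - y') + ((x - y) * y' + y * (x' - y')) by ring.
move=> /msuppD_le; rewrite mem_cat => /orP[|/msuppD_le].
  case/msuppM_le/allpairsP=> -[m1 m2] [/xy lt1 /xy' lt2 ->].
  by rewrite mdegD -addSn leq_add // ltnW.
rewrite mem_cat => /orP[] /msuppM_le/allpairsP[[m1 m2] []] /=.
  by move=> /xy lt1 /yeE e2 ->; rewrite mdegD e2 ltn_add2r.
by move=> /ydE e1 /xy' lt2 ->; rewrite mdegD e1 ltn_add2l.
Qed.

Lemma leading_form_prod (R : comNzRingType) (n : nat) (I : Type) (r : seq I)
    (P : pred I) (d : I -> nat) (x y : I -> {mpoly R[n]}) :
  (forall i, P i -> leading_form (d i) (x i) (y i)) ->
  leading_form (\sum_(i <- r | P i) d i)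
    (\prod_(i <- r | P i) x i) (\prod_(i <- r | P i) y i).
Proof.
move=> xy; elim/big_rec3: _ => [|i k X Y Pi]; last exact/leading_formM/xy.
by split=> [|m]; rewrite ?dhomog1 // subrr msupp0.
Qed.

Lemma leading_form_subC (R : nzRingType) (n d : nat) (y : {mpoly R[n]}) (c : R) :
  y \is d.+1.-homog -> leading_form d.+1 (y - c%:MP) y.
Proof.
move=> yd; split=> // m; rewrite addrC addKr (perm_mem (msuppN _)) msuppC.
by case: ifP => // _; rewrite inE => /eqP->; rewrite mdeg0.
Qed.

(** As a monomial of the homogeneous [y], [t] has degree [d], above all monomials of [x - y]. The
    conclusion is what the Nullstellensatz requires. *)
Lemma leading_form_coef (R : nzRingType) (n d : nat) (x y : {mpoly R[n]})
    (t : 'X_{1..n}) :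
  leading_form d x y -> y@_t != 0 ->
  x@_t != 0 /\ forall m, m \in msupp x -> (mdeg m <= mdeg t)%N.
Proof.
move=> [/dhomogP yd xy] yt; have td : mdeg t = d by apply: yd; rewrite mcoeff_msupp.
split=> [|m].
  rewrite -[x](subrK y) mcoeffD (memN_msupp_eq0 (p := x - y)) ?add0r //.
  by apply/negP => /xy; rewrite td ltnn.
rewrite td -[x](subrK y) => /msuppD_le; rewrite mem_cat => /orP[/xy/ltnW //|/yd->].
exact: leqnn.
Qed.

(** * Arithmetic of ['F_3] *)

Lemma F3_sqr (x : 'F_3) : x != 0 -> x ^+ 2 = 1.
Proof. by case: x => -[|[|[|//]]] i // _; apply/val_inj. Qed.

(** The product of the two candidate differences is [(q - q') ^+ 2 - (r - r') ^+ 2], and nonzero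
    squares in ['F_3] equal 1. *)
Lemma F3_sub_or_add (q q' r r' : 'F_3) :
  q != q' -> r != r' -> q - r = q' - r' \/ q + r = q' + r'.
Proof.
rewrite -subr_eq0 -(subr_eq0 r) => /F3_sqr qE /F3_sqr rE.
have /eqP : (q - r - (q' - r')) * (q + r - (q' + r')) = 0.
  transitivity ((q - q') ^+ 2 - (r - r') ^+ 2); first by ring.
  by rewrite qE rE subrr.
by rewrite mulf_eq0 !subr_eq0 => /orP[]/eqP; [left|right].
Qed.

(** Any two points of the graph of [s] agree in [q - r] or in [q + r]. If two of them differ in
    [q - r], they agree in [q + r], and every third point, unable to match both differences, shares
    that sum. *)
Lemma F3_partial_injection (s : 'F_3 -> option 'F_3) :
  (forall q q' r, s q = Some r -> s q' = Some r -> q = q') ->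
  (exists c, forall q r, s q = Some r -> q - r = c) \/
  (exists c, forall q r, s q = Some r -> q + r = c).
Proof.
move=> s_inj.
have alt q q' r r' : s q = Some r -> s q' = Some r' ->
    q - r = q' - r' \/ q + r = q' + r'.
  move=> sq sq'; have [qq'|qq'] := eqVneq q q'.
    by move: sq' sq; rewrite qq' => -> [->]; left.
  have [rr'|rr'] := eqVneq r r'; last exact: F3_sub_or_add.
  by rewrite rr' in sq; rewrite (s_inj _ _ _ sq sq') eqxx in qq'.
pose bad (x : ('F_3 * 'F_3) * ('F_3 * 'F_3)) :=
  [&& s x.1.1 == Some x.1.2, s x.2.1 == Some x.2.2
    & x.1.1 - x.1.2 != x.2.1 - x.2.2].
have [[[q r] [q' r']] /and3P[/= /eqP sq /eqP sq' /eqP ne]|nobad] := pickP bad.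
  right; exists (q + r) => q2 r2 sq2.
  have qr' : q + r = q' + r' by case: (alt _ _ _ _ sq sq').
  have [e|//] := alt _ _ _ _ sq2 sq.
  by case: (alt _ _ _ _ sq2 sq') => // [e'|->//]; case: ne; rewrite -e.
left; have [[q r] /eqP sq|s0] := pickP [pred x | s x.1 == Some x.2].
  exists (q - r) => q' r' sq'; apply/eqP/negPn/negP => ne.
  by have := nobad ((q', r'), (q, r)); rewrite /bad /= sq' sq !eqxx ne.
by exists 0 => q r sq; have := s0 (q, r); rewrite /= sq eqxx.
Qed.

(** * Names and conflicts in a cover *)

Section Cover.

Variables (G H : sgraph) (L : G -> {set H}) (name : H -> G * 'F_3).
Hypotheses (hL : is_cover L) (hname : is_naming L name).

Lemma name_fst (u : G) (x : H) : x \in L u -> (name x).1 = u.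
Proof.
have [_ /(_ u)/subsetP nameL] := hname; move=> xu.
by have /imsetP[j _ ->] := nameL _ (imset_f name xu).
Qed.

Lemma mem_name (x : H) : x \in L (name x).1.
Proof.
have [[cov _] _ _ _] := hL.
have : x \in [set: H] by [].
rewrite -cov => /bigcupP[u _ /[dup] xu /name_fst->]; exact: xu.
Qed.

(** Matching edges with a common endpoint are equal as sets, and disjointness of the lists keeps
    their endpoints from trading places. *)
Lemma cover_matching (u v : G) (x x' y y' : H) :
  adj u v -> x \in L u -> x' \in L u -> y \in L v -> y' \in L v ->
  adj x y -> adj x' y' -> (x == x') = (y == y').
Proof.
move=> uv xu x'u yv y'v xy x'y'; have [[_ disj] _ _ match_uv] := hL.
have u_v : u != v by apply: contraTneq uv => ->; rewrite adj_irr.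
have ne z z' : z \in L u -> z' \in L v -> (z == z') = false.
  move=> zu zv; apply: contraTF zv => /eqP<-.
  by rewrite (disjointFr (disj _ _ u_v) zu).
have edge z z' : z \in L u -> z' \in L v -> adj z z' ->
    [set z; z'] \in edges_between (L u) (L v).
  move=> zu zv zz'; rewrite inE; apply/existsP; exists z; rewrite zu /=.
  by apply/existsP; exists z'; rewrite zv zz' /=.
have /trivIsetP/(_ _ _ (edge _ _ xu yv xy) (edge _ _ x'u y'v x'y')) tri :=
  match_uv _ _ uv.
have shared z : z \in [set x; y] -> z \in [set x'; y'] -> [set x; y] = [set x'; y'].
  by move=> z1 z2; apply/eqP/negPn/negP => /tri /disjointFr/(_ z1); rewrite z2.
apply/eqP/eqP => e.
  have /setP/(_ y) : [set x; y] = [set x'; y'].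
    by apply: (shared x); rewrite !inE ?e eqxx.
  by rewrite !inE eqxx orbT eq_sym ne //= => /esym/eqP.
have /setP/(_ x) : [set x; y] = [set x'; y'].
  by apply: (shared y); rewrite !inE ?e eqxx orbT.
by rewrite !inE eqxx /= (ne x y') // orbF => /esym/eqP.
Qed.

(** The [pick] chooses some [r]; the matching condition leaves only one choice. *)
Lemma saturationP (u v : G) (q r : 'F_3) : adj u v ->
  reflect (exists x y, [/\ name x = (u, q), name y = (v, r) & adj x y])
          (saturation name u v q == Some r).
Proof.
move=> uv; have inL z w c : name z = (w, c) -> z \in L w.
  by move=> zw; have := mem_name z; rewrite zw.
rewrite /saturation; apply: (iffP eqP) => [|[x [y [xq yr xy]]]].
  case: pickP => // r' /existsP[x /existsP[y /and3P[/eqP xq /eqP yr xy]]] [<-].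
  by exists x, y.
case: pickP => [r' /existsP[x' /existsP[y' /and3P[/eqP x'q /eqP yr' x'y']]]|].
  have [name_inj _] := hname; have xx' : x' = x by apply: name_inj; rewrite xq.
  have := cover_matching uv (inL _ _ _ x'q) (inL _ _ _ xq) (inL _ _ _ yr')
    (inL _ _ _ yr) x'y' xy.
  by rewrite xx' eqxx => /esym/eqP e; move: yr'; rewrite e yr => -[->].
move/(_ r)/negbT/negP; case; apply/existsP; exists x; apply/existsP; exists y.
by rewrite xq yr xy !eqxx.
Qed.

(** The matching condition makes [saturation] injective, so the dichotomy applies; in the bad case
    constant differences are excluded and constant sums remain. *)
Lemma Bsign_saturation (u v : G) : adj u v ->
  exists c : 'F_3, forall q r, saturation name u v q = Some r ->
    q + Bsign name u v * r = c.
Proof.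
move=> uv; rewrite /Bsign; case: ifPn => [/existsP[c /forallP c_good]|bad].
  exists c => q r sq; have /forallP/(_ r) := c_good q.
  by rewrite sq eqxx mulN1r => /eqP.
have [q q' r /eqP/(saturationP _ _ uv) [x [y [xq yr xy]]]
    /eqP/(saturationP _ _ uv) [x' [y' [xq' yr' xy']]]|[c cE]|[c cE]] :=
    @F3_partial_injection (saturation name u v).
- have [name_inj _] := hname; have yy' : y = y' by apply: name_inj; rewrite yr.
  have inL z w c : name z = (w, c) -> z \in L w.
    by move=> zw; have := mem_name z; rewrite zw.
  have := cover_matching uv (inL _ _ _ xq) (inL _ _ _ xq') (inL _ _ _ yr)
    (inL _ _ _ yr') xy xy'.
  by rewrite yy' eqxx => /eqP e; move: xq; rewrite e xq' => -[].
- case/negP: bad; apply/existsP; exists c; apply/forallP => q.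
  by apply/forallP => r; apply/implyP => /eqP/cE->.
- by exists c => q r /cE; rewrite mul1r.
Qed.

End Cover.

Theorem theorem3p2 (n : nat) (G : sgraph) (v : 'I_n -> G) (hv : bijective v)
    (H : sgraph) (L : G -> {set H}) (hL : prime_cover3 L)
    (name : H -> G * 'F_3) (hname : is_naming L name)
    (t : 'X_{1..n}) (ht : (cover_poly name v)@_t != 0)
    (hLt : forall i : 'I_n, (t i < #|L (v i)|)%N) :
  exists I : {set H}, is_coloring G I.
Proof.
have {hL}[hL _] := hL; have [name_inj _] := hname.
have [_ _ edge_cover _] := hL.
pose E := [pred p : 'I_n * 'I_n | adj (v p.1) (v p.2) && (p.1 < p.2)%N].
(* Pairs outside [E] receive the dummy constant 0. *)
have /fin_all_exists[c cE] (p : 'I_n * 'I_n) : exists c : 'F_3, E p ->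
    forall q r, saturation name (v p.1) (v p.2) q = Some r ->
    q + Bsign name (v p.1) (v p.2) * r = c.
  have [/andP[uv _]|] := boolP (E p); last by exists 0.
  by have [c cE] := Bsign_saturation hL hname uv; exists c.
pose B (p : 'I_n * 'I_n) := Bsign name (v p.1) (v p.2).
pose l (p : 'I_n * 'I_n) : {mpoly 'F_3[n]} := 'X_(p.1) + B p *: 'X_(p.2).
pose f := \prod_(p | E p) (l p - (c p)%:MP).
have f_lead : leading_form (\sum_(p | E p) 1) f (cover_poly name v).
  apply: leading_form_prod => p _; apply: leading_form_subC.
  by apply: dhomogD; last apply: dhomogZ; rewrite dhomogX /= mdeg1.
have [ft f_deg] := leading_form_coef f_lead ht.
(* Names in [L (v i)] share their first component, so their second components are distinct and [S i]
   has size [#|L (v i)|]. *)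
pose S i := [seq (name x).2 | x <- enum (L (v i))].
have [i|i|a aS fa] := combinatorial_nullstellensatz (S := S) ft f_deg.
- rewrite map_inj_in_uniq ?enum_uniq // => x y; rewrite !mem_enum.
  move=> /(name_fst hname) xi /(name_fst hname) yi xy; apply: name_inj.
  by rewrite [name x]surjective_pairing [name y]surjective_pairing xi yi xy.
- by rewrite size_map -cardE.
have /fin_all_exists[h hE] i : exists x : H, name x = (v i, a i).
  have /mapP[x] := aS i; rewrite mem_enum => /(name_fst hname) xi ->.
  by exists x; rewrite -xi -surjective_pairing.
have v_inj := bij_inj hv.
have h_inj : injective h.
  by move=> i j e; apply: v_inj; have := hE i; rewrite e hE => -[].
have hL_mem i : h i \in L (v i) by have := mem_name hL hname (h i); rewrite hE.
(* An edge from [h i] to [h j] would force [v i] and [v j] to be adjacent, with a saturation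
   function sending [a i] to [a j], so the factor of [f] at [(i, j)] would vanish at [a]. *)
have h_indep (i j : 'I_n) : (i < j)%N -> ~~ adj (h i) (h j).
  move=> ij; apply/negP => hij.
  have vij : adj (v i) (v j).
    have [|/v_inj e|//] := edge_cover (v i) (v j).
      apply/set0Pn; exists [set h i; h j]; rewrite inE; apply/existsP.
      exists (h i); rewrite hL_mem; apply/existsP; exists (h j).
      by rewrite hL_mem hij eqxx.
    by rewrite e ltnn in ij.
  have /eqP sij : saturation name (v i) (v j) (a i) == Some (a j).
    by apply/(saturationP hL hname _ _ vij); exists (h i), (h j).
  have Eij : E (i, j) by rewrite /= vij ij.
  move/negP: fa; apply; rewrite rmorph_prod (bigD1 (i, j)) //=.
  rewrite mevalB mevalD mevalZ !mevalXU mevalC /= /B (cE _ Eij _ _ sij).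
  by rewrite subrr mul0r.
exists (h @: [set: 'I_n]); split.
  move=> x y /imsetP[i _ ->] /imsetP[j _ ->].
  have [ij|ji|/val_inj->] := ltngtP i j; first exact: h_indep.
    by rewrite adj_sym h_indep.
  by rewrite adj_irr.
by rewrite card_imset // cardsT (bij_eq_card hv).
Qed.
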